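(* Let $k\ge 1$ be an integer and let $p$ be a permutation of the set $W_2^{k-1}$. Consider the unitaries $u_p^{\pm}\in\mathcal{P}_2^k$ given by $$u_p^+=\sum_{\mu\in W_2^{k-1}} \Big((S_\mu S_2)(S_2 S_{p(\mu)})^*+(S_\mu S_1)(S_1S_{p(\mu)})^*\Big),$$ $$u_p^-=\sum_{\mu\in W_2^{k-1}} \Big((S_\mu S_1)(S_2 S_{p(\mu)})^*+(S_\mu S_2)(S_1S_{p(\mu)})^*\Big).$$ Then both endomorphisms $\lambda_{u_p^{+}}$ and $\lambda_{u_p^-}$ of $\mathcal{O}_2$ extend to endomorphisms $\widetilde\lambda_{u_p^{+}}$, $\widetilde\lambda_{u_p^-}$ of $\mathcal{Q}_2$ with $\widetilde\lambda_{u_p^{\pm}}(U)=U^{\pm 2^{k-1}}$.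
   Context: The $2$-adic ring $C^*$-algebra $\mathcal{Q}_2$ is the universal $C^*$-algebra generated by a unitary $U$ and an isometry $S_2$ such that $S_2U=U^2S_2$ and $S_2S_2^*+US_2S_2^*U^*=1$. Put $S_1:=US_2$. The Cuntz algebra $\mathcal{O}_2$ is identified with the $C^*$-subalgebra $C^*(S_1,S_2)\subset\mathcal{Q}_2$. Let $W_2^n:=\{1,2\}^n$ be the set of multi-indices of length $n$; for $\mu=(\mu_1,\dots,\mu_n)$ put $S_\mu:=S_{\mu_1}\cdots S_{\mu_n}$ (with $S_\emptyset=1$). $\mathcal{P}_2^k$ is the set of unitaries in $\mathcal{O}_2$ of the form $\sum_{i=1}^n S_{\alpha_i}S_{\beta_i}^*$ with $|\alpha_i|=|\beta_i|=k$ for all $i$. For a unitary $u\in\mathcal{O}_2$, $\lambda_u$ is the unital $*$-endomorphism of $\mathcal{O}_2$ determined by $\lambda_u(S_i)=uS_i$, $i=1,2$. *)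

(* Defs.v *)
From HB Require Import structures.
From mathcomp Require Import all_boot all_order all_algebra all_fingroup complex.
From mathcomp Require Import all_classical all_reals all_analysis.

Set Implicit Arguments.
Unset Strict Implicit.
Unset Printing Implicit Defensive.

Import Order.TTheory GRing.Theory Num.Theory.
Import numFieldNormedType.Exports.

Local Open Scope classical_set_scope.
Local Open Scope ring_scope.

(* Unital C*-algebras over the complex numbers R[i]. As for every normed module
   over R[i], the norm takes its (nonnegative real) values in R[i].
   The multiplication is part of this mixin, and the ring and algebra structures
   are derived from it below: Hierarchy Builder rejects a structure inheriting
   from both a ring and a normed module, since numDomainType already joins
   rings and norms. *)
HB.mixin Record isCStarAlgebra (R : realType) (A : Type)
    of CompleteNormedModule R[i] A := {
  cstar_one : A;
  cstar_mul : A -> A -> A;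
  cstar_mulA : associative cstar_mul;
  cstar_mul1x : left_id cstar_one cstar_mul;
  cstar_mulx1 : right_id cstar_one cstar_mul;
  cstar_mulDl : left_distributive cstar_mul +%R;
  cstar_mulDr : right_distributive cstar_mul +%R;
  cstar_oner_neq0 : cstar_one != 0;
  cstar_scaleAl : forall (a : R[i]) (x y : A),
    a *: cstar_mul x y = cstar_mul (a *: x) y;
  cstar_scaleAr : forall (a : R[i]) (x y : A),
    a *: cstar_mul x y = cstar_mul x (a *: y);
  star : A -> A;
  starD : {morph star : x y / x + y};
  starZ : forall (a : R[i]) (x : A), star (a *: x) = a^* *: star x;
  cstar_starM : forall x y : A, star (cstar_mul x y) = cstar_mul (star y) (star x);
  starK : involutive star;
  cstar_normM_le : forall x y : A, `|cstar_mul x y| <= `|x| * `|y|;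
  cstar_norm_starM : forall x : A, `|cstar_mul (star x) x| = `|x| ^+ 2
}.

#[short(type="cstarAlgType")]
HB.structure Definition CStarAlgebra (R : realType) :=
  { A of isCStarAlgebra R A & CompleteNormedModule R[i] A }.

#[non_forgetful_inheritance]
HB.instance Definition _ (R : realType) (A : cstarAlgType R) :=
  GRing.Zmodule_isNzRing.Build (CStarAlgebra.sort A)
    cstar_mulA cstar_mul1x cstar_mulx1 cstar_mulDl cstar_mulDr cstar_oner_neq0.

#[non_forgetful_inheritance]
HB.instance Definition _ (R : realType) (A : cstarAlgType R) :=
  GRing.Lmodule_isLalgebra.Build R[i] (CStarAlgebra.sort A) cstar_scaleAl.

#[non_forgetful_inheritance]
HB.instance Definition _ (R : realType) (A : cstarAlgType R) :=
  GRing.Lalgebra_isAlgebra.Build R[i] (CStarAlgebra.sort A) cstar_scaleAr.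

Section CStarNotions.
Context {R : realType}.
Implicit Types A B : cstarAlgType R.

Lemma starM A : {morph @star R A : x y / x * y >-> y * x}.
Proof. exact: cstar_starM. Qed.

Lemma normrM_le A (x y : A) : `|x * y| <= `|x| * `|y|.
Proof. exact: cstar_normM_le. Qed.

Lemma norm_starM A (x : A) : `|star x * x| = `|x| ^+ 2.
Proof. exact: cstar_norm_starM. Qed.

Definition isometry A (s : A) : Prop := star s * s = 1.

Definition unitary A (u : A) : Prop := star u * u = 1 /\ u * star u = 1.

(* Together with the structure of [f], this makes [f] a unital *-homomorphism. *)
Definition star_preserving A B (f : {lrmorphism A -> B}) : Prop :=
  forall x, f (star x) = star (f x).

Definition cstar_subalgebra A (D : set A) : Prop :=
  [/\ D 0,
      forall x y, D x -> D y -> D (x + y),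
      forall (a : R[i]) x, D x -> D (a *: x),
      forall x y, D x -> D y -> D (x * y) &
      forall x, D x -> D (star x)] /\ closed D.

Definition cstar_gen A (G : set A) : set A := smallest (@cstar_subalgebra A) G.

(* Unital *-endomorphisms of a subalgebra [D] containing 1; the values of [f]
   outside [D] are irrelevant. *)
Definition star_endo_on A (D : set A) (f : A -> A) : Prop :=
  [/\ set_fun D D f,
      forall (a : R[i]) x y, D x -> D y -> f (a *: x + y) = a *: f x + f y,
      forall x y, D x -> D y -> f (x * y) = f x * f y,
      forall x, D x -> f (star x) = star (f x) &
      f 1 = 1].

Definition Q2_relations A (U S2 : A) : Prop :=
  [/\ unitary U, isometry S2, S2 * U = U ^+ 2 * S2 &
      S2 * star S2 + U * S2 * star S2 * star U = 1].

(* [Q] is the 2-adic ring C*-algebra with canonical generators [U] and [S2]. *)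
Definition is_Q2 (Q : cstarAlgType R) (U S2 : Q) : Prop :=
  [/\ Q2_relations U S2,
      cstar_gen [set U; S2] = setT &
      forall (B : cstarAlgType R) (V T : B), Q2_relations V T ->
        exists f : {lrmorphism Q -> B},
          [/\ star_preserving f, f U = V & f S2 = T]].

Section Cuntz.
Context (Q : cstarAlgType R) (U S2 : Q).

Definition S1 : Q := U * S2.

(* The letters 1 and 2 are encoded as [false] and [true]. *)
Definition Sletter (b : bool) : Q := if b then S2 else S1.

Definition Sword (w : seq bool) : Q := \prod_(b <- w) Sletter b.

Definition O2 : set Q := cstar_gen [set S1; S2].

Definition P2 (k : nat) : set Q := [set u |
  [/\ O2 u, unitary u &
      exists s : seq (k.-tuple bool * k.-tuple bool),
        u = \sum_(ab <- s) Sword ab.1 * star (Sword ab.2)]].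

Definition is_lambda (u : Q) (lam : Q -> Q) : Prop :=
  [/\ star_endo_on O2 lam, lam S1 = u * S1 & lam S2 = u * S2].

Definition u_plus (n : nat) (p : {perm n.-tuple bool}) : Q :=
  \sum_(mu : n.-tuple bool)
    ((Sword mu * S2) * star (S2 * Sword (p mu))
     + (Sword mu * S1) * star (S1 * Sword (p mu))).

Definition u_minus (n : nat) (p : {perm n.-tuple bool}) : Q :=
  \sum_(mu : n.-tuple bool)
    ((Sword mu * S1) * star (S2 * Sword (p mu))
     + (Sword mu * S2) * star (S1 * Sword (p mu))).

(* The endomorphism lambda_u of O_2 exists, and it extends to an endomorphism of
   Q mapping U to V. *)
Definition lambda_extends (u V : Q) : Prop :=
  (exists lam, is_lambda u lam) /\
  forall lam, is_lambda u lam ->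
    exists phi : {lrmorphism Q -> Q},
      [/\ star_preserving phi, forall x, O2 x -> phi x = lam x & phi U = V].

End Cuntz.
End CStarNotions.

(* Main.v *)
Require Import Defs.
From mathcomp Require Import all_boot all_order all_algebra all_fingroup complex.
From mathcomp Require Import all_classical all_reals all_analysis.
Set Implicit Arguments.
Unset Strict Implicit.
Unset Printing Implicit Defensive.
Import Order.TTheory GRing.Theory Num.Theory.
Import numFieldNormedType.Exports.
Local Open Scope classical_set_scope.
Local Open Scope ring_scope.

(** Write [n = k - 1], let [W] be [U] or its adjoint
    according to the sign, and put [V = W ^ (2 ^ n)]. The relation
    [S_2 U = U ^ 2 S_2] gives [W ^ 2 S_c = S_c W] for both letters [c], hence
    [V S_mu = S_mu W] for every word [mu] of length [n]: multiplication by [V]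
    turns, after passing a word of length [n], into multiplication by [W], and
    [W] exchanges the two letters in the direction prescribed by the sign.

    Let [T_c] be the sum over [mu] of [S_mu S_c S_p(mu)^*]. Up to the order
    fixed by the sign, [u S_2] and [u S_1] are the two isometries [T_c]. They
    have orthogonal ranges with sum 1, since [p] merely permutes the words
    ([perm_isometry_orth], [perm_isometry_full]); so [u] is unitary. The
    preceding remark gives [V u S_2 = u S_1] and [u S_2 V = V ^ 2 u S_2].
    Thus [V] and [u S_2] satisfy the defining relations of Q_2
    ([perm_isometry_relations]), and universality provides an endomorphism
    [phi] with [phi U = V], [phi S_2 = u S_2], whence [phi S_1 = u S_1].

    It remains to compare [phi] with [lambda_u] on the C*-algebra generated by
    [S_1] and [S_2], while both are known only to be algebraic *-homomorphisms.
    Agreement on generators is enough once *-homomorphisms are known to be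
    continuous ([star_endo_contractive]); continuity of [phi] also shows that
    [phi] maps that subalgebra into itself, so that [lambda_u] exists.

    Continuity reduces to a self-adjoint [h] of norm less than 1, because
    [|f x| ^ 2 = |f (x^* x)|]. Inside the domain there is a self-adjoint square
    root [y] of [1 - h ^ 2] that commutes with [h] ([sqrt_one_minus_sqr]). Then
    [f h + i f y] is an isometry, since its adjoint times itself is
    [f (h ^ 2 + y ^ 2) = 1]; so its norm is 1, and [f h], its real part, has
    norm at most 1. *)

(** * Contractions in complex Banach spaces *)

Lemma exprC_small (R : realType) (r e : R[i]) :
  0 <= r -> r < 1 -> 0 < e -> exists n, r ^+ n < e.
Proof.
case: r e => [r ri] [e ei]; rewrite lecE ltcE /= => /andP[/eqP -> r0].
rewrite eqxx /= => r1; rewrite ltcE /= => /andP[/eqP -> e0].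
have /cvgrPdist_lt/(_ e e0)[n _ /(_ n (leqnn n))] : r ^+ n @[n --> \oo] --> 0.
  by apply: cvg_expr; rewrite ger0_norm.
rewrite /= sub0r normrN ger0_norm ?exprn_ge0// => rne; exists n.
have -> : (r +i* 0)%C ^+ n = (r ^+ n)%:C%C by rewrite rmorphXn.
by rewrite ltcR.
Qed.

Lemma le0_small (K : numFieldType) (x M : K) : 0 <= M ->
  (forall e, 0 < e -> x <= M * e) -> x <= 0.
Proof.
move=> M0 xM; apply/ler_addgt0Pr => e e0; rewrite add0r.
have M1 : 0 < M + 1 by rewrite ltr_wpDl.
apply: le_trans (xM (e / (M + 1)) _) _; first by rewrite divr_gt0.
by rewrite mulrCA ler_piMr ?(ltW e0)// ler_pdivrMr// mul1r lerDl.
Qed.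

Lemma norm_small_eq0 (K : numFieldType) (V : normedModType K) (x : V) (M : K) :
  0 <= M -> (forall e, 0 < e -> `|x| <= M * e) -> x = 0.
Proof.
by move=> M0 xM; apply/eqP; rewrite -normr_le0; apply: le0_small xM.
Qed.

(** Lets closedness be proved and used by norm estimates alone. *)
Lemma closed_normP (K : numFieldType) (V : normedModType K) (A : set V) :
  closed A <->
  forall x, (forall e, 0 < e -> exists2 y, A y & `|x - y| < e) -> A x.
Proof.
split=> [clA x xA|clA x Ax].
  apply: clA => B /nbhs_ballP[e /= e0 xB].
  have [y Ay xy] := xA e e0; exists y; split=> //; apply: xB.
  by rewrite -ball_normE.
apply: clA => e e0.
have [y [Ay]] := Ax (ball x e) (nbhsx_ballx x _ e0).
by rewrite -ball_normE; exists y.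
Qed.

(** The contraction principle for complex scalars: norms are here elements of
    [R[i]] and not of [R], which is why the decay of [r ^ n] comes from
    [exprC_small]. *)
Lemma contraction_fixed_point (R : realType) (X : completeNormedModType R[i])
    (D : set X) (F : X -> X) (r : R[i]) (b : X) :
  closed D -> D b -> set_fun D D F -> 0 <= r -> r < 1 ->
  (forall x y, D x -> D y -> `|F x - F y| <= r * `|x - y|) ->
  exists2 x, D x & F x = x.
Proof.
move=> clD Db DF r0 r1 ctr; pose y n := iter n F b.
have Dy n : D (y n) by elim: n => //= n; apply: DF.
have yn n m : `|y n - y (n + m)%N| <= r ^+ n * `|b - y m|.
  elim: n => [|n IH]; first by rewrite expr0 mul1r.
  rewrite addSn exprS -mulrA; apply: le_trans (ctr _ _ (Dy _) (Dy _)) _.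
  exact: ler_wpM2l.
pose C := `|b - F b| / (1 - r).
have C0 : 0 <= C by rewrite divr_ge0// subr_ge0 ltW.
have y0 m : `|b - y m| <= C.
  elim: m => [|m IH]; first by rewrite subrr normr0.
  apply: le_trans (ler_distD (F b) _ _) _.
  apply: (@le_trans _ _ (`|b - F b| + r * C)).
    by rewrite lerD2l (le_trans (ctr _ _ Db (Dy _)))// ler_wpM2l.
  have <- : C * (1 - r) = `|b - F b|.
    by rewrite divfK// subr_eq0 eq_sym lt_eqF.
  by rewrite mulrBr mulr1 mulrC subrK.
have cy : cvg (y n @[n --> \oo]).
  apply/cauchy_cvgP/cauchy_exP => e e0.
  have eC : 0 < e / (C + 1) by rewrite divr_gt0// ltr_wpDl.
  have [N rN] := exprC_small r0 r1 eC.
  exists (y N); exists N => // n /= Nn; rewrite -ball_normE /= -(subnKC Nn).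
  apply: le_lt_trans (yn _ _) _.
  apply: (@le_lt_trans _ _ (r ^+ N * (C + 1))).
    by rewrite ler_wpM2l ?exprn_ge0// (le_trans (y0 _))// lerDl.
  by rewrite -ltr_pdivlMr// ltr_wpDl.
have Dl : D (lim (y n @[n --> \oo])).
  by apply: closed_cvg cy => //; apply: nearW => n; exact: Dy.
exists (lim (y n @[n --> \oo])) => //; set l := lim _ in Dl *.
apply/eqP; rewrite -subr_eq0; apply/eqP.
apply: (@norm_small_eq0 _ _ _ 2) => // e e0.
have /cvgrPdist_lt/(_ e e0)[N _ le] : y n @[n --> \oo] --> l by [].
apply: le_trans (ler_distD (y N.+1) _ _) _; rewrite mulr_natl mulr2n lerD//.
  apply: le_trans (ctr _ _ Dl (Dy _)) _.
  by rewrite -[leRHS]mul1r ler_pM// ltW// le//=.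
by rewrite distrC ltW// le//=.
Qed.

(** * Norm and topology of a C*-algebra *)

Section CStar.
Context {R : realType}.
Implicit Types A : cstarAlgType R.

Lemma star0 A : star 0 = 0 :> A.
Proof. by rewrite -{1}(scale0r (0 : A)) starZ rmorph0 scale0r. Qed.

Lemma star1 A : star 1 = 1 :> A.
Proof. by rewrite -[LHS]mul1r -{1}[1](starK (1 : A)) -starM mul1r starK. Qed.

Lemma starB A : {morph @star R A : x y / x - y}.
Proof. by move=> x y; rewrite starD -scaleN1r starZ rmorphN1 scaleN1r. Qed.

Lemma star_sum A (I : Type) (s : seq I) (P : pred I) (F : I -> A) :
  star (\sum_(i <- s | P i) F i) = \sum_(i <- s | P i) star (F i).
Proof. by apply: (big_morph (@star R A) (@starD R A) (star0 A)). Qed.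

Lemma norm_star A (x : A) : `|star x| = `|x|.
Proof.
suff le (y : A) : `|y| <= `|star y|.
  by apply/eqP; rewrite eq_le le -{2}[x]starK le.
have [->|y0] := eqVneq y 0; first by rewrite normr0.
by rewrite -(ler_pM2r (_ : 0 < `|y|)) ?normr_gt0// -expr2 -norm_starM normrM_le.
Qed.

Lemma norm_isometry A (w : A) : Defs.isometry w -> `|w| = 1.
Proof.
have n1 : `|1 : A| = 1.
  have n0 : `|1 : A| != 0 by rewrite normr_eq0 oner_eq0.
  by apply: (mulfI n0); rewrite mulr1 -expr2 -norm_starM star1 mul1r.
move=> w1; apply/eqP; rewrite -(@pexpr_eq1 _ _ 2)// -norm_starM w1.
exact/eqP.
Qed.

Lemma closed_lipschitz_preimage A (D E : set A) (g : A -> A) (M : R[i]) :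
  closed D -> closed E -> 0 <= M ->
  (forall x y, D x -> D y -> `|g x - g y| <= M * `|x - y|) ->
  closed [set x | D x /\ E (g x)].
Proof.
move=> clD clE M0 gM; apply/closed_normP => x xDE.
have Dx : D x.
  move/closed_normP: clD; apply => e /xDE[y [Dy _] xy]; by exists y.
split=> //; move/closed_normP: clE; apply => e e0.
have M1 : 0 < M + 1 by rewrite ltr_wpDl.
have [|y [Dy Ey] xy] := xDE (e / (M + 1)); first by rewrite divr_gt0.
exists (g y) => //; apply: le_lt_trans (gM _ _ Dx Dy) _.
apply: (@le_lt_trans _ _ ((M + 1) * `|x - y|)).
  by rewrite ler_wpM2r// lerDl.
by rewrite mulrC -ltr_pdivlMr.
Qed.

Lemma closed_ball0 A (r : R[i]) : closed [set x : A | `|x| <= r].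
Proof.
apply/closed_normP => x xr; apply/ler_addgt0Pr => e /xr[y /= yr xy].
by rewrite -(subrK y x) addrC (le_trans (ler_normD _ _))// lerD// ltW.
Qed.

Lemma closed_lipschitz_equalizer A (D : set A) (f g : A -> A) (M : R[i]) :
  closed D -> 0 <= M ->
  (forall x y, D x -> D y -> `|f x - f y| <= M * `|x - y|) ->
  (forall x y, D x -> D y -> `|g x - g y| <= M * `|x - y|) ->
  closed [set x | D x /\ f x = g x].
Proof.
move=> clD M0 fM gM.
have cl0 : closed [set 0 : A].
  apply/closed_normP => x x0; apply: (@norm_small_eq0 _ _ _ 1) => //.
  by move=> e /x0[y ->]; rewrite subr0 mul1r; apply: ltW.
have -> : [set x | D x /\ f x = g x] = [set x | D x /\ [set 0] (f x - g x)].
  apply/seteqP; split=> x [Dx] /=; first by move=> ->; rewrite subrr.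
  by move=> /eqP; rewrite subr_eq0 => /eqP.
apply: (closed_lipschitz_preimage clD cl0 (_ : 0 <= 2 * M)).
  by rewrite mulr_ge0.
move=> x y Dx Dy; rewrite opprD opprK addrACA [- g x + _]addrC.
rewrite -mulrA mulr_natl mulr2n (le_trans (ler_normD _ _))// lerD//.
  exact: fM.
by rewrite [X in _ <= _ * X]distrC gM.
Qed.

(** The square root is [1 - z], where [z] solves the fixed-point equation
    [z = (h ^ 2 + z ^ 2) / 2]. On the ball of radius [r = |h| ^ 2 < 1] the
    right-hand side is a contraction of ratio [r], and it preserves the closed
    set of self-adjoint elements of [D] that commute with [h]. *)
Lemma sqrt_one_minus_sqr A (D : set A) (h : A) :
  cstar_subalgebra D -> D 1 -> D h -> star h = h -> `|h| < 1 ->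
  exists y, [/\ D y, star y = y, h * y = y * h & y * y = 1 - h * h].
Proof.
move=> [[D0 DD DZ DM DS] clD] D1 Dh sh h1.
pose r := `|h| ^+ 2; pose F z := 2^-1 *: (h * h + z * z) : A.
have r0 : 0 <= r by rewrite exprn_ge0.
have r1 : r < 1 by rewrite exprn_ilt1.
have hh : `|h * h| <= r by rewrite (le_trans (normrM_le _ _)).
have half (x : A) : 2^-1 *: x + 2^-1 *: x = x.
  by rewrite -scalerDl -div1r -splitr scale1r.
have nhalf (x : A) : `|2^-1 *: x| = 2^-1 * `|x|.
  by rewrite normrZ ger0_norm// invr_ge0.
pose E0 := [set z : A | D z /\ `|z| <= r].
pose E1 := [set z : A | E0 z /\ h * z = z * h].
pose E := [set z : A | E1 z /\ star z = z].
have clE0 : closed E0.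
  apply: (@closed_lipschitz_preimage _ D [set x | `|x| <= r] id 1) => //.
    exact: closed_ball0.
  by move=> x y _ _; rewrite mul1r.
have clE1 : closed E1.
  apply: (closed_lipschitz_equalizer clE0 (normr_ge0 h)) => x y _ _.
    by rewrite -mulrBr normrM_le.
  by rewrite -mulrBl mulrC normrM_le.
have clE : closed E.
  apply: (@closed_lipschitz_equalizer A E1 (@star R A) id 1) => // x y _ _.
    by rewrite -starB norm_star mul1r.
  by rewrite mul1r.
have [|||z [[[Dz zr] hz] sz] Fz] :=
    @contraction_fixed_point _ A E F r 0 clE _ _ r0 r1.
- by split; [split; [split; rewrite ?normr0|rewrite mulr0 mul0r]|exact: star0].
- move=> z [[[Dz zr] hz] sz]; split; first split; first split.
  + by apply/DZ/DD; apply: DM.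
  + rewrite nhalf -ler_pdivlMl ?invr_gt0// invrK mulr_natl mulr2n.
    rewrite (le_trans (ler_normD _ _))// lerD// (le_trans (normrM_le _ _))//.
    by rewrite -[leRHS]mulr1 ler_pM// (le_trans zr)// ltW.
  + rewrite /F -scalerAr -scalerAl !mulrDr !mulrDl !mulrA hz.
    by rewrite -(mulrA z h z) hz mulrA.
  + by rewrite /F starZ starD !starM sh sz fmorphV rmorph_nat.
- move=> x y [[[_ xr] _] _] [[[_ yr] _] _].
  rewrite /F -scalerBr opprD addrACA subrr add0r nhalf.
  have -> : x * x - y * y = x * (x - y) + (x - y) * y.
    by rewrite mulrBr mulrBl addrA subrK.
  rewrite -ler_pdivlMl ?invr_gt0// invrK mulr_natl mulr2n.
  rewrite (le_trans (ler_normD _ _))// lerD// (le_trans (normrM_le _ _))//.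
    exact: ler_wpM2r.
  by rewrite mulrC ler_wpM2r.
have zz : z + z = h * h + z * z by rewrite -{1 2}Fz half.
exists (1 - z); split.
- by apply: DD => //; rewrite -scaleN1r; apply: DZ.
- by rewrite starB star1 sz.
- by rewrite mulrBr mulrBl mulr1 mul1r hz.
- have -> : h * h = z + (z - z * z) by rewrite addrA zz addrK.
  by rewrite mulrBr mulr1 mulrBl mul1r [in RHS]opprD [in RHS]addrA.
Qed.

(** * Automatic continuity of *-homomorphisms *)

Section StarEndo.
Context (A : cstarAlgType R) (D : set A) (f : A -> A).
Hypotheses (subD : cstar_subalgebra D) (D1 : D 1) (endo : star_endo_on D f).

Lemma star_endo0 : f 0 = 0.
Proof.
case: endo subD => _ fL _ _ _ [[D0 _ _ _ _] _].
have := fL 1 0 0 D0 D0; rewrite !scale1r addr0 => /eqP.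
by rewrite -subr_eq0 opprD addNKr oppr_eq0 => /eqP.
Qed.

Lemma star_endoZ a x : D x -> f (a *: x) = a *: f x.
Proof.
case: endo subD => _ fL _ _ _ [[D0 _ _ _ _] _] Dx.
by have := fL a x 0 Dx D0; rewrite star_endo0 !addr0.
Qed.

Lemma star_endoD x y : D x -> D y -> f (x + y) = f x + f y.
Proof.
by case: endo => _ fL _ _ _ Dx Dy; have := fL 1 x y Dx Dy; rewrite !scale1r.
Qed.

(** The element [w = f h + i f y], with [y] a square root of [1 - h ^ 2], is an
    isometry whose real part is [f h]. *)
Lemma star_endo_unit_ball_selfadj h :
  D h -> star h = h -> `|h| < 1 -> `|f h| <= 1.
Proof.
case: endo => _ _ fM fS f1 Dh sh h1.
have [y [Dy sy hy yy]] := sqrt_one_minus_sqr subD D1 Dh sh h1.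
case: subD => [[_ _ _ DM _] _].
have sfh : star (f h) = f h by rewrite -fS// sh.
have sfy : star (f y) = f y by rewrite -fS// sy.
have fhy : f h * f y = f y * f h by rewrite -!fM// hy.
pose w := f h + 'i *: f y.
have sw : star w = f h - 'i *: f y.
  by rewrite starD starZ sfh sfy conjCi scaleNr.
have wi : Defs.isometry w.
  rewrite /Defs.isometry sw mulrBl !mulrDr -!scalerAr -!scalerAl fhy.
  rewrite scalerA -(expr2 'i) sqrCi scaleN1r opprD opprK addrA addrK.
  by rewrite -!fM// -star_endoD//; [rewrite yy addrC subrK|exact: DM..].
have -> : f h = 2^-1 *: (w + star w).
  rewrite sw addrACA subrr addr0 scalerDr -scalerDl -div1r -splitr scale1r//.
rewrite normrZ ger0_norm ?invr_ge0// ler_pdivrMl// mulr1.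
by rewrite (le_trans (ler_normD _ _))// norm_star norm_isometry.
Qed.

(** For every [e > 0] the element [y = x / (|x| + e)] has norm less than 1, so
    the self-adjoint case applies to [y^* y], and the C*-identity gives
    [|f y| <= 1]. The slack [e] also covers [x = 0]. *)
Lemma star_endo_contractive x : D x -> `|f x| <= `|x|.
Proof.
move=> Dx; case: (endo) (subD) => _ _ fM fS _ [[_ _ DZ DM DS] _].
apply/ler_addgt0Pr => e e0.
have xe : 0 < `|x| + e by rewrite ltr_wpDl.
have xe' : `|(`|x| + e)^-1| = (`|x| + e)^-1 by rewrite ger0_norm// invr_ge0 ltW.
pose y := (`|x| + e)^-1 *: x.
have Dy : D y by exact: DZ.
have y1 : `|y| < 1 by rewrite normrZ xe' ltr_pdivrMl// mulr1 ltrDl.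
have : `|f (star y * y)| <= 1.
  apply: star_endo_unit_ball_selfadj.
  - by apply: DM => //; apply: DS.
  - by rewrite starM starK.
  - by rewrite norm_starM exprn_ilt1.
rewrite fM//; last exact: DS.
rewrite fS// norm_starM expr_le1// star_endoZ// normrZ xe' ler_pdivrMl//.
by rewrite mulr1.
Qed.

Lemma star_endoB_le x y : D x -> D y -> `|f x - f y| <= `|x - y|.
Proof.
case: (subD) => [[_ DD DZ _ _] _] Dx Dy.
have DNy : D (- y) by rewrite -scaleN1r; apply: DZ.
have -> : f x - f y = f (x - y).
  by rewrite star_endoD// -[- y]scaleN1r star_endoZ// scaleN1r.
by apply: star_endo_contractive; apply: DD.
Qed.
End StarEndo.

(** * Subalgebras generated by a set *)

Section Generated.
Context (A : cstarAlgType R).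
Implicit Types G D : set A.

Lemma cstar_subalgebraT : cstar_subalgebra [set: A].
Proof. by split=> //; exact: closedT. Qed.

Lemma sub_cstar_gen G : G `<=` cstar_gen G.
Proof. exact: sub_smallest. Qed.

Lemma cstar_gen_sub G D : cstar_subalgebra D -> G `<=` D -> cstar_gen G `<=` D.
Proof. exact: smallest_sub. Qed.

Lemma cstar_subalgebra_gen G : cstar_subalgebra (cstar_gen G).
Proof.
split; last by apply: closed_bigI => D [[]].
split=> [D [[[]]] //|x y Gx Gy D DG|a x Gx D DG|x y Gx Gy D DG|x Gx D DG];
  have [[[D0 DD DZ DM DS] _] _] := DG.
- by apply: DD; [exact: Gx|exact: Gy].
- by apply: DZ; exact: Gx.
- by apply: DM; [exact: Gx|exact: Gy].
- by apply: DS; exact: Gx.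
Qed.

Lemma cstar_subalgebra_sum D (I : Type) (s : seq I) (F : I -> A) :
  cstar_subalgebra D -> (forall i, D (F i)) -> D (\sum_(i <- s) F i).
Proof. by move=> [[D0 DD _ _ _] _] DF; apply: big_ind => // *; apply: DF. Qed.

(** The equalizer of [f] and [g] is a *-subalgebra, and it is closed by
    contractivity; this is where continuity enters. *)
Lemma star_endo_eq_on_gen G (f g : A -> A) : cstar_gen G 1 ->
  star_endo_on (cstar_gen G) f -> star_endo_on (cstar_gen G) g ->
  (forall x, G x -> f x = g x) -> forall x, cstar_gen G x -> f x = g x.
Proof.
move=> G1 ef eg fg; have subG := cstar_subalgebra_gen G.
suff sub : cstar_gen G `<=` [set x | cstar_gen G x /\ f x = g x].
  by move=> x /sub[].
case: (subG) (ef) (eg) => [[D0 DD DZ DM DS] clG] [_ _ fM fS _] [_ _ gM gS _].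
apply: cstar_gen_sub => [|x Gx]; last first.
  by split; [exact: sub_cstar_gen|exact: fg].
split; last first.
  apply: (@closed_lipschitz_equalizer A _ f g 1) => // x y Gx Gy;
    by rewrite mul1r; apply: (star_endoB_le subG).
split=> [|x y|a x|x y|x] /=.
- by rewrite (star_endo0 subG ef) (star_endo0 subG eg).
- move=> [Gx fx] [Gy fy]; split; first exact: DD.
  by rewrite (star_endoD ef)// (star_endoD eg)// fx fy.
- move=> [Gx fx]; split; first exact: DZ.
  by rewrite (star_endoZ subG ef)// (star_endoZ subG eg)// fx.
- move=> [Gx fx] [Gy fy]; split; first exact: DM.
  by rewrite fM// gM// fx fy.
- move=> [Gx fx]; split; first exact: DS.
  by rewrite fS// gS// fx.
Qed.

(** The elements that [f] maps into the generated subalgebra form themselves a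
    C*-subalgebra, closed because [f] is contractive. *)
Lemma star_endo_on_gen G (f : A -> A) : star_endo_on setT f ->
  (forall x, G x -> cstar_gen G (f x)) -> star_endo_on (cstar_gen G) f.
Proof.
move=> ef Gf; have [_ fL fM fS f1] := ef.
have subT := cstar_subalgebraT; have subG := cstar_subalgebra_gen G.
case: (subG) => [[D0 DD DZ DM DS] clG].
suff sub : cstar_gen G `<=` [set x | [set: A] x /\ cstar_gen G (f x)].
  split=> [x /sub[]//|a x y _ _|x y _ _|x _|//].
  - exact: fL.
  - exact: fM.
  - exact: fS.
apply: cstar_gen_sub => [|x Gx]; last by split; [|exact: Gf].
split; last first.
  apply: (@closed_lipschitz_preimage A setT (cstar_gen G) f 1) => //.
  by move=> x y _ _; rewrite mul1r; apply: (star_endoB_le subT).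
split=> [|x y|a x|x y|x] /=.
- by rewrite (star_endo0 subT ef).
- by move=> [_ fx] [_ fy]; split=> //; rewrite (star_endoD ef)//; exact: DD.
- by move=> [_ fx]; split=> //; rewrite (star_endoZ subT ef)//; exact: DZ.
- by move=> [_ fx] [_ fy]; split=> //; rewrite fM//; exact: DM.
- by move=> [_ fx]; split=> //; rewrite fS//; exact: DS.
Qed.

End Generated.
End CStar.

(** * Cuntz families and words *)

Lemma starX (R : realType) (A : cstarAlgType R) (x : A) n :
  star (x ^+ n) = star x ^+ n.
Proof.
by elim: n => [|n IH]; rewrite ?expr0 ?star1// exprS starM IH -exprSr.
Qed.

Lemma unitaryX (R : realType) (A : cstarAlgType R) (x : A) n :
  Defs.unitary x -> Defs.unitary (x ^+ n).
Proof.
move=> [x1 x2]; rewrite /Defs.unitary starX.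
by split; rewrite -exprMn_comm ?x1 ?x2 ?expr1n// /GRing.comm x1 x2.
Qed.

Lemma big_cons_tuple (V : nmodType) n (F : seq bool -> V) :
  \sum_(mu : n.+1.-tuple bool) F mu =
  \sum_(b : bool) \sum_(mu : n.-tuple bool) F (b :: mu).
Proof.
rewrite pair_bigA /=.
rewrite (reindex
  (fun bm : bool * n.-tuple bool => [tuple of bm.1 :: bm.2])) //=.
exists (fun t : n.+1.-tuple bool => (thead t, [tuple of behead t])).
  move=> [b m] _.
  by congr (_, _) => //; apply: val_inj.
by move=> t _; rewrite /= [RHS]tuple_eta.
Qed.

(** Two families of isometries with pairwise orthogonal ranges of sum 1 are
    exchanged by a unitary, sending each [s i] to [t i]. *)
Lemma cuntz_change_unitary (R : realType) (A : cstarAlgType R) (I : finType)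
    (s t : I -> A) :
  (forall i j, star (s i) * s j = (i == j)%:R) ->
  (forall i j, star (t i) * t j = (i == j)%:R) ->
  \sum_i s i * star (s i) = 1 -> \sum_i t i * star (t i) = 1 ->
  Defs.unitary (\sum_i t i * star (s i)).
Proof.
have half (v w : I -> A) : (forall i j, star (w i) * w j = (i == j)%:R) ->
    \sum_i v i * star (v i) = 1 ->
    (\sum_i v i * star (w i)) * (\sum_i w i * star (v i)) = 1.
  move=> ow <-; rewrite mulr_suml; apply: eq_bigr => i _.
  rewrite mulr_sumr (bigD1 i)//= big1 => [|j ji];
    rewrite -mulrA [star (w _) * _]mulrA ow.
    by rewrite eqxx mul1r addr0.
  by rewrite eq_sym (negPf ji) mul0r mulr0.
move=> os ot rs rt.
have st : star (\sum_i t i * star (s i)) = \sum_i s i * star (t i).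
  by rewrite star_sum; apply: eq_bigr => i _; rewrite starM starK.
by split; rewrite st; apply: half.
Qed.

Section Words.
Context {R : realType} (Q : cstarAlgType R) (U S2 : Q).
Hypothesis rel : Q2_relations U S2.
Local Notation L := (Sletter U S2).
Local Notation S := (Sword U S2).
Local Notation S1 := (S1 U S2).

Lemma Sletter_range : \sum_(b : bool) L b * star (L b) = 1.
Proof.
by case: rel => _ _ _ <-; rewrite big_bool /= /Defs.S1 starM !mulrA.
Qed.

Lemma Sletter_orth a b : star (L a) * L b = (a == b)%:R.
Proof.
have [[U1 U2] i2 _ _] := rel.
have i1 : star S1 * S1 = 1.
  by rewrite /Defs.S1 starM -mulrA [star U * _]mulrA U1 mul1r.
have o12 : star S1 * S2 = 0.
  have := Sletter_range; rewrite big_bool /=.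
  move=> /(congr1 (fun x => star S2 * x * S2)).
  (* compressing the range relation by S_2 gives |S_1^* S_2| ^ 2 = 0 *)
  rewrite mulr1 [RHS]i2 mulrDr mulrDl !mulrA i2 mul1r i2.
  move/eqP; rewrite -subr_eq0 addrAC subrr add0r -mulrA => /eqP e.
  have : `|star S1 * S2| ^+ 2 = 0.
    by rewrite -norm_starM starM starK !mulrA in e *; rewrite e normr0.
  by move/eqP; rewrite expf_eq0 /= normr_eq0 => /eqP.
case: a b => [] [] //=; first by rewrite -[RHS]star0 -o12 starM starK.
Qed.

Lemma Sword_cons b w : S (b :: w) = L b * S w.
Proof. exact: big_cons. Qed.

Lemma Sword_rcons b w : S (rcons w b) = S w * L b.
Proof. by rewrite /Sword -cats1 big_cat big_seq1. Qed.

Lemma Sword_orth v w : size v = size w -> star (S v) * S w = (v == w)%:R.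
Proof.
elim: v w => [|a v IH] [|b w] //= => [_|[/IH vw]].
  by rewrite /Sword big_nil star1 mulr1.
rewrite !Sword_cons starM -mulrA [star (L a) * _]mulrA Sletter_orth eqseq_cons.
by case: (a == b); rewrite ?mul0r ?mulr0// mul1r vw.
Qed.

Lemma Sword_tuple_orth n (v w : n.-tuple bool) : star (S v) * S w = (w == v)%:R.
Proof. by rewrite Sword_orth ?size_tuple// eq_sym. Qed.

Lemma Sword_range n : \sum_(mu : n.-tuple bool) S mu * star (S mu) = 1.
Proof.
elim: n => [|n IH].
  rewrite (bigD1 [tuple])//= big1 => [|i /eqP[]]; last exact: tuple0.
  by rewrite /Sword big_nil star1 mulr1 addr0.
rewrite (big_cons_tuple _ (fun w => S w * star (S w))) -[RHS]Sletter_range.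
apply: eq_bigr => b _; rewrite -[X in _ = X * _]mulr1 -IH mulr_sumr mulr_suml.
by apply: eq_bigr => mu _; rewrite Sword_cons starM !mulrA.
Qed.

Local Notation O2 := (O2 U S2).

Lemma O2_Sletter b : O2 (L b).
Proof. by apply: sub_cstar_gen; case: b; [right|left]. Qed.

Lemma O2_1 : O2 1.
Proof.
rewrite -Sletter_range; have subO := cstar_subalgebra_gen [set S1; S2].
apply: (cstar_subalgebra_sum _ subO) => b; case: subO => [[_ _ _ DM DS] _].
by apply: DM; [|apply: DS]; exact: O2_Sletter.
Qed.

Lemma O2_Sword w : O2 (S w).
Proof.
have [[_ _ _ DM _] _] := cstar_subalgebra_gen [set S1; S2].
elim: w => [|b w IH]; first by rewrite /Sword big_nil; exact: O2_1.
by rewrite Sword_cons; apply: DM; [exact: O2_Sletter|].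
Qed.

(** Both signs of the theorem are treated at once: the boolean [b] is the sign,
    [true] for plus, and the encoding of letters makes [L b] the letter that
    [W b] moves to the other one. *)
Definition signedU (b : bool) : Q := if b then U else star U.
Local Notation W := signedU.

Lemma signedU_unitary b : Defs.unitary (W b).
Proof. by have [[U1 U2] _ _ _] := rel; case: b; split; rewrite /= ?starK. Qed.

Lemma star_signedU b : star (W b) = W (~~ b).
Proof. by case: b => //=; rewrite starK. Qed.

Lemma signedU_Sletter b : W b * L b = L (~~ b).
Proof.
have [[U1 U2] _ _ _] := rel.
by case: b => //=; rewrite /Defs.S1 mulrA U1 mul1r.
Qed.

Lemma sqr_signedU_Sletter b c : W b ^+ 2 * L c = L c * W b.
Proof.
have [[U1 U2] _ SU _] := rel.
have pos : U ^+ 2 * L c = L c * U.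
  by case: c => //=; rewrite /Defs.S1 -[RHS]mulrA SU !mulrA -exprSr exprS.
case: b => //=; have [W1 W2] := unitaryX 2 (signedU_unitary true).
rewrite -[LHS]mulr1 -U2 mulrA -[_ * L c * U]mulrA -pos mulrA -starX W1 mul1r.
by [].
Qed.

(** Each letter crossed halves the exponent, by [sqr_signedU_Sletter]. *)
Lemma signedU_Sword b w : W b ^+ (2 ^ size w) * S w = S w * W b.
Proof.
elim: w => [|c w IH]; first by rewrite expn0 expr1 /Sword big_nil mulr1 mul1r.
have comm m : (W b ^+ 2) ^+ m * L c = L c * W b ^+ m.
  elim: m => [|m IHm]; first by rewrite !expr0 mulr1 mul1r.
  by rewrite exprSr -mulrA sqr_signedU_Sletter mulrA IHm -mulrA -exprSr.
by rewrite /= expnS exprM Sword_cons mulrA comm -mulrA IH mulrA.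
Qed.

Section Perm.
Variables (n : nat) (p : {perm n.-tuple bool}).

(** The isometries [u S_2] and [u S_1], for both signs at once; see
    [signedu_S2] and [signedu_S1]. *)
Definition perm_isometry (c : bool) : Q :=
  \sum_(mu : n.-tuple bool) S mu * L c * star (S (p mu)).
Definition signedu (b : bool) : Q :=
  if b then u_plus U S2 p else u_minus U S2 p.
Definition signedU_pow (b : bool) : Q := W b ^+ (2 ^ n).
Local Notation u := signedu.
Local Notation T := perm_isometry.
Local Notation V := signedU_pow.

Lemma signedU_pow_unitary b : Defs.unitary (V b).
Proof. exact/unitaryX/signedU_unitary. Qed.

Lemma signeduE b : u b = T b * star S2 + T (~~ b) * star S1.
Proof.
rewrite /T !mulr_suml -big_split /=.
by case: b; apply: eq_bigr => mu _ /=; rewrite !starM !mulrA.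
Qed.

Lemma signedu_S2 b : u b * S2 = T b.
Proof.
have := Sletter_orth true true; have := Sletter_orth false true => /= o i.
by rewrite signeduE mulrDl -!mulrA i o mulr1 mulr0 addr0.
Qed.

Lemma signedu_S1 b : u b * S1 = T (~~ b).
Proof.
have := Sletter_orth true false; have := Sletter_orth false false => /= o i.
by rewrite signeduE mulrDl -!mulrA i o mulr1 mulr0 add0r.
Qed.

(** Orthogonality of words of equal length leaves the diagonal terms, and what
    remains is the sum of the range projections of words, reindexed by [p]. *)
Lemma perm_isometry_orth c d : star (T c) * T d = (c == d)%:R.
Proof.
rewrite /T star_sum mulr_suml.
transitivity (\sum_(mu : n.-tuple bool)
                (c == d)%:R * (S (p mu) * star (S (p mu)))).
  apply: eq_bigr => mu _; rewrite mulr_sumr (bigD1 mu)//= big1 => [|nu nmu].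
    rewrite addr0 !starM starK -!mulrA [star (S mu) * _]mulrA.
    rewrite Sword_tuple_orth eqxx mul1r [star (L c) * _]mulrA Sletter_orth.
    by case: (c == d); rewrite ?mul1r// !mul0r mulr0.
  rewrite !starM starK -!mulrA [star (S mu) * _]mulrA.
  by rewrite Sword_tuple_orth (negPf nmu) mul0r !mulr0.
rewrite -mulr_sumr -[RHS]mulr1; congr (_ * _).
rewrite -[RHS](Sword_range n) [RHS](reindex_inj (@perm_inj _ p)).
by [].
Qed.

Lemma perm_isometry_range c : T c * star (T c) =
  \sum_(mu : n.-tuple bool) S mu * (L c * star (L c)) * star (S mu).
Proof.
rewrite /T star_sum mulr_suml; apply: eq_bigr => mu _.
rewrite mulr_sumr (bigD1 mu)//= big1 => [|nu nmu].
  rewrite addr0 !starM starK -!mulrA [star (S (p mu)) * _]mulrA.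
  by rewrite Sword_tuple_orth eqxx mul1r.
rewrite !starM starK -!mulrA [star (S (p mu)) * _]mulrA Sword_tuple_orth.
by rewrite (inj_eq perm_inj) (negPf nmu) mul0r !mulr0.
Qed.

Lemma perm_isometry_full b : T b * star (T b) + T (~~ b) * star (T (~~ b)) = 1.
Proof.
have -> : T b * star (T b) + T (~~ b) * star (T (~~ b)) =
          \sum_(c : bool) T c * star (T c).
  by rewrite big_bool /=; case: b => //=; rewrite addrC.
rewrite -[RHS](Sword_range n); under eq_bigr do rewrite perm_isometry_range.
rewrite exchange_big; apply: eq_bigr => mu _.
by rewrite -mulr_suml -mulr_sumr Sletter_range mulr1.
Qed.

Lemma signedU_pow_perm_isometry b : V b * T b = T (~~ b).
Proof.
rewrite /T mulr_sumr; apply: eq_bigr => mu _; rewrite !mulrA.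
have := signedU_Sword b mu; rewrite size_tuple => ->.
by rewrite -[X in X * _]mulrA signedU_Sletter.
Qed.

(** On the right, [V b] crosses [S_p(mu)^*] and becomes [W b] (the adjoint of
    [signedU_Sword] for the opposite sign); it then crosses the letter as
    [W b ^ 2], and the word [mu] as [V b ^ 2]. *)
Lemma perm_isometry_signedU_pow b c : T c * V b = V b ^+ 2 * T c.
Proof.
rewrite /T mulr_sumr mulr_suml; apply: eq_bigr => mu _.
have VS d (nu : n.-tuple bool) : V d * S nu = S nu * W d.
  by have := signedU_Sword d nu; rewrite size_tuple.
have SV : star (S (p mu)) * V b = W b * star (S (p mu)).
  have := VS (~~ b) (p mu) => /(congr1 (@star _ Q)).
  by rewrite !starM /V starX !star_signedU negbK.
have V2S : V b ^+ 2 * S mu = S mu * W b ^+ 2.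
  by rewrite !expr2 -mulrA VS mulrA VS mulrA.
rewrite -mulrA SV !mulrA V2S -[S mu * W b ^+ 2 * _]mulrA.
by rewrite sqr_signedU_Sletter !mulrA.
Qed.

Lemma signedu_sum b : u b = \sum_(c : bool) T (b == c) * star (L c).
Proof. by rewrite big_bool signeduE; case: b. Qed.

Lemma signedu_unitary b : Defs.unitary (u b).
Proof.
rewrite signedu_sum; apply: cuntz_change_unitary.
- exact: Sletter_orth.
- by move=> c d; rewrite perm_isometry_orth; case: b c d => [] [] [].
- exact: Sletter_range.
- by rewrite big_bool -(perm_isometry_full b); case: b.
Qed.

Lemma perm_isometry_relations b : Q2_relations (V b) (T b).
Proof.
split.
- exact: signedU_pow_unitary.
- by rewrite /Defs.isometry perm_isometry_orth eqxx.
- exact: perm_isometry_signedU_pow.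
- rewrite signedU_pow_perm_isometry -mulrA -starM.
  by rewrite signedU_pow_perm_isometry perm_isometry_full.
Qed.

Lemma O2_perm_isometry c : O2 (T c).
Proof.
have subO := cstar_subalgebra_gen [set S1; S2].
apply: (cstar_subalgebra_sum _ subO) => mu; have [[_ _ _ DM DS] _] := subO.
by apply: (DM); [apply: (DM)|apply: DS];
  first [exact: O2_Sword|exact: O2_Sletter].
Qed.

Lemma signedu_P2 b : P2 U S2 n.+1 (u b).
Proof.
have subO := cstar_subalgebra_gen [set S1; S2]; split.
- have [[_ DD _ DM DS] _] := subO; rewrite signeduE.
  by apply: DD; (apply: DM; [exact: O2_perm_isometry|apply: DS]);
    [exact: (O2_Sletter true)|exact: (O2_Sletter false)].
- exact: signedu_unitary.
exists [seq ([tuple of rcons cm.2 (b == cm.1)], [tuple of cm.1 :: p cm.2])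
       | cm : bool * n.-tuple bool <- index_enum (bool * n.-tuple bool)%type].
rewrite big_map -(pair_bigA _ (fun c (mu : n.-tuple bool) =>
  S (rcons mu (b == c)) * star (S (c :: p mu)))) /=.
rewrite signedu_sum; apply: eq_bigr => c _.
rewrite /T mulr_suml; apply: eq_bigr => mu _.
by rewrite Sword_rcons Sword_cons starM !mulrA.
Qed.

End Perm.
End Words.

(** * The extension of lambda_u *)

Lemma star_endo_lrmorphism (R : realType) (A : cstarAlgType R)
    (phi : {lrmorphism A -> A}) : star_preserving phi -> star_endo_on setT phi.
Proof.
move=> phiS; split=> //= [a x y _ _|x y _ _|].
- exact: linearP.
- exact: rmorphM.
- exact: rmorph1.
Qed.

(** The endomorphism [phi] given by universality serves twice: its restriction
    to O_2 is a [lambda_u], and by uniqueness on O_2 it extends every other. *)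
Lemma lambda_signedu_extends (R : realType) (Q : cstarAlgType R) (U S2 : Q)
    (hQ : is_Q2 U S2) n (p : {perm n.-tuple bool}) b :
  lambda_extends U S2 (signedu U S2 p b) (signedU_pow U n b).
Proof.
have [rel _ univ] := hQ.
have [phi [phiS phiU phiS2]] := univ _ _ _ (perm_isometry_relations rel p b).
have phi2 : phi S2 = signedu U S2 p b * S2 by rewrite phiS2 signedu_S2.
have phi1 : phi (S1 U S2) = signedu U S2 p b * S1 U S2.
  rewrite signedu_S1//; transitivity (phi U * phi S2); first exact: rmorphM.
  by rewrite phiU phiS2 signedU_pow_perm_isometry.
have endo : star_endo_on (O2 U S2) phi.
  apply: star_endo_on_gen; first exact: star_endo_lrmorphism.
  move=> x [->|->]; first by rewrite phi1 signedu_S1//; exact: O2_perm_isometry.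
  by rewrite phi2 signedu_S2//; exact: O2_perm_isometry.
split; first by exists phi.
move=> lam [lamE lam1 lam2]; exists phi; split=> //.
apply: star_endo_eq_on_gen => //; first exact: O2_1.
by move=> x [->|->]; rewrite ?lam1 ?lam2.
Qed.

(* For the unitary U, the power U^{-n} is (U^* )^n. *)
Theorem theorem8p2 (R : realType) (Q : cstarAlgType R) (U S2 : Q)
    (hQ : is_Q2 U S2) (k : nat) (hk : (1 <= k)%N)
    (p : {perm k.-1.-tuple bool}) :
  [/\ P2 U S2 k (u_plus U S2 p),
      P2 U S2 k (u_minus U S2 p),
      lambda_extends U S2 (u_plus U S2 p) (U ^+ (2 ^ k.-1)) &
      lambda_extends U S2 (u_minus U S2 p) (star U ^+ (2 ^ k.-1))].
Proof.
have [rel _ _] := hQ.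
case: k hk p => // n _ p; split.
- exact: (signedu_P2 rel p true).
- exact: (signedu_P2 rel p false).
- exact: (lambda_signedu_extends hQ p true).
- exact: (lambda_signedu_extends hQ p false).
Qed.
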